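(* For every integer $s\ge 0$, $$f_{\{2s+1,2s+2\}}(n)=(1+o(1))\frac{n}{s+1}\quad\text{as } n\to\infty.$$
   Context: For a set $\mathcal{L}$ of positive integers, $f_{\mathcal{L}}(n)$ denotes the maximum number of vectors in $\{0,1\}^n$ such that the Hamming distance between any two distinct ones lies in $\mathcal{L}$. The Hamming distance between two vectors is the number of coordinates in which they differ. *)

(* Defs.v *)
From mathcomp Require Import all_boot.
Set Implicit Arguments.
Unset Strict Implicit.
Unset Printing Implicit Defensive.

Definition hamming_dist (n : nat) (x y : {ffun 'I_n -> bool}) : nat :=
  #|[set i : 'I_n | x i != y i]|.

Definition has_dists (L : {pred nat}) (n : nat)
    (A : {set {ffun 'I_n -> bool}}) : bool :=
  [forall x in A, forall y in A, (x != y) ==> (hamming_dist x y \in L)].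

(* The [\max] ranges over a nonempty family: [has_dists L set0] always holds. *)
Definition max_code (L : {pred nat}) (n : nat) : nat :=
  \max_(A : {set {ffun 'I_n -> bool}} | has_dists L A) #|A|.

(* Main.v *)
(** Recording the parity of the distance from x to a fixed codeword x0 in an
    extra coordinate turns a code with distances 2s+1 and 2s+2 into an
    equidistant one, of distance 2k with k = s+1.  Translated by x0, it becomes a family of 2k-sets
    meeting pairwise in k points.  If such a family is large, then by the
    pigeonhole principle many members have the same trace S on a fixed member,
    hence form a sunflower with kernel S; a set missing a point of S would have
    to meet every petal, so all members contain S, and their disjoint petals of
    size k give k #|F| <= n + 1 (a weak form of Deza's theorem).  Conversely the
    indicators of disjoint blocks of length k are at mutual distance 2k.  Hence
    k f(n) = n + O(1). *)
Require Import Defs.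
From mathcomp Require Import all_boot zify.

Set Implicit Arguments.
Unset Strict Implicit.
Unset Printing Implicit Defensive.

(** * Sunflowers and equidistant set families *)

Lemma leq_card_petals (T : finType) (F : {set {set T}}) (S : {set T}) (k : nat) :
    {in F, forall X : {set T}, k <= #|X :\: S|} ->
    {in F &, forall X Y : {set T}, X != Y -> X :&: Y \subset S} ->
  #|F| * k <= #|T|.
Proof.
move=> Fk FS; rewrite -sum_nat_const.
apply: (@leq_trans (\sum_(X in F) \sum_(t in X :\: S) 1)).
  by apply: leq_sum => X XF; rewrite sum1_card Fk.
(* Double counting: a point [t] lies in at most one petal. *)
rewrite (exchange_big_dep xpredT) //= -sum1_card; apply: leq_sum => t _.
rewrite sum1dep_card; apply/card_le1_eqP => X Y; rewrite !inE.
move=> /and3P[XF tS tX] /and3P[YF _ tY].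
apply/eqP; apply: contraT => XY.
have /subsetP/(_ t) := FS _ _ YF XF XY.
by rewrite inE tX tY (negPf tS) => /(_ isT).
Qed.

(** [X] meets every petal [B :\: S], and the petals are disjoint, so picking a point of [X] in each
    is injective. *)
Lemma leq_card_transversal (T : finType) (G : {set {set T}}) (S X : {set T}) :
    {in G, forall B : {set T}, ~~ (X :&: B \subset S)} ->
    {in G &, forall B C : {set T}, B != C -> B :&: C \subset S} ->
  #|G| <= #|X|.
Proof.
move=> GX GS.
have petal B : B \in G -> exists t, t \in (X :&: B) :\: S.
  by move=> BG; apply/set0Pn; rewrite setD_eq0 GX.
have [->|[B0 B0G]] := set_0Vmem G; first by rewrite cards0.
have [t0 _] := petal _ B0G.
pose f B := odflt t0 [pick t in (X :&: B) :\: S].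
have fP B : B \in G -> f B \in (X :&: B) :\: S.
  rewrite /f => /petal[t tB]; case: pickP => //= /(_ t).
  by rewrite tB.
rewrite -(@card_in_imset _ _ f).
  apply: subset_leq_card; apply/subsetP => _ /imsetP[B BG ->].
  by have := fP _ BG; rewrite !inE => /and3P[].
move=> B C BG CG fBC; apply/eqP; apply: contraT => BC.
have /subsetP/(_ (f B)) := GS _ _ BG CG BC.
have := fP _ CG; rewrite -fBC; have := fP _ BG.
by rewrite !inE => /and3P[/negPf-> _ ->] /and3P[_ _ ->] /(_ isT).
Qed.

Lemma pigeonhole_fiber (T U : finType) (F : {set T}) (P : {set U}) (f : T -> U)
    (m : nat) :
    {in F, forall x, f x \in P} -> #|P| * m < #|F| ->
  exists2 y, y \in P & m < #|[set x in F | f x == y]|.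
Proof.
move=> fP; rewrite ltnNge => /negP nF; apply/exists_inP; apply: contraT.
rewrite negb_exists_in => /forall_inP small; case: nF.
rewrite -sum1_card (partition_big f (mem P)) //= -sum_nat_const.
by apply: leq_sum => y yP; rewrite sum1dep_card leqNgt small.
Qed.

Lemma large_equidistant_family (T : finType) (k : nat) (F : {set {set T}}) :
    {in F, forall B : {set T}, #|B| = 2 * k} ->
    {in F &, forall B C : {set T}, B != C -> #|B :&: C| = k} ->
    (2 ^ (2 * k) * (2 * k)).+1 < #|F| ->
  #|F| * k <= #|T|.
Proof.
move=> Fc FI Fbig.
have [B0 B0F] : exists B, B \in F by apply/set0Pn; rewrite -card_gt0; lia.
(* There are [2 ^ (2 * k)] possible traces; the extra 1 in the threshold pays for removing [B0]. A
   fiber with more than [2 * k] members outnumbers the points of any member of [F]. *)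
have [S _ Gbig] : exists2 S, S \in powerset B0 &
    2 * k < #|[set B in F :\ B0 | B :&: B0 == S]|.
  apply: (@pigeonhole_fiber _ _ _ _ (fun B => B :&: B0)).
    by move=> B _; rewrite inE subsetIr.
  by rewrite card_powerset Fc //; move: Fbig; rewrite (cardsD1 B0 F) B0F.
set G := [set B in _ | _] in Gbig.
have GF B : B \in G -> B \in F by rewrite !inE => /andP[/andP[]].
have GS B : B \in G -> S \subset B.
  by rewrite !inE => /andP[_ /eqP<-]; rewrite subsetIl.
have cS : #|S| = k.
  have [B] : exists B, B \in G by apply/set0Pn; rewrite -card_gt0; lia.
  by rewrite !inE => /andP[/andP[BB0 BF] /eqP <-]; apply: FI.
have kernel (B C : {set T}) : B \in F -> C \in F -> B != C ->
    S \subset B -> S \subset C -> B :&: C \subset S.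
  move=> BF CF BC SB SC.
  suff /eqP <- : S == B :&: C by [].
  by rewrite eqEcard subsetI SB SC FI // cS /=.
have FS X : X \in F -> S \subset X.
  move=> XF; apply: contraT => nSX.
  suff : #|G| <= #|X| by rewrite (Fc X) // leqNgt Gbig.
  apply: (@leq_card_transversal _ _ S) => [B BG | B C BG CG BC].
    (* If [X] missed the petal of [B], then [X :&: B], having size [k] like [S], would equal [S]. *)
    apply: contra (nSX) => XBS.
    have XB : X != B by apply: contraNneq nSX => ->; exact: GS.
    have /eqP <- : X :&: B == S by rewrite eqEcard XBS cS FI ?leqnn ?(GF B).
    exact: subsetIl.
  by apply: kernel => //; [exact: GF | exact: GF | exact: GS | exact: GS].
apply: (@leq_card_petals _ _ S) => [X XF | X Y XF YF XY].
  by rewrite cardsDS ?FS // Fc // cS; lia.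
by apply: kernel; rewrite ?FS.
Qed.

(** * Parity extension of a code *)

Lemma card_option_set (T : finType) (A : {set option T}) :
  #|A| = (None \in A) + #|[set i | Some i \in A]|.
Proof.
rewrite (cardsD1 None); congr (_ + _).
rewrite -(card_imset _ (@Some_inj _ : injective (@Some T))).
apply: eq_card => -[i|].
  rewrite !inE /=; apply/idP/imsetP => [iA|[j jA [->]]].
    by exists i => //; rewrite inE.
  by rewrite inE in jA.
by rewrite !inE /=; apply/esym/imsetP => -[].
Qed.

Section ParityExtension.
Variables (n : nat) (x0 : {ffun 'I_n -> bool}).
Implicit Types x y : {ffun 'I_n -> bool}.

Definition diff_set x : {set 'I_n} := [set i | x i != x0 i].

Definition parity_ext x : {set option 'I_n} :=
  [set o | if o is Some i then i \in diff_set x else odd #|diff_set x|].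

Lemma card_parity_ext x : #|parity_ext x| = odd #|diff_set x| + #|diff_set x|.
Proof.
rewrite card_option_set inE; congr (_ + _).
by apply: eq_card => i; rewrite !inE.
Qed.

Lemma card_parity_extI x y : #|parity_ext x :&: parity_ext y| =
  (odd #|diff_set x| && odd #|diff_set y|) + #|diff_set x :&: diff_set y|.
Proof.
rewrite card_option_set !inE; congr (_ + _).
by apply: eq_card => i; rewrite !inE.
Qed.

Lemma card_diff_set x : #|diff_set x| = hamming_dist x x0.
Proof. by []. Qed.

Lemma hamming_dist_diff_set x y :
  #|diff_set x| + #|diff_set y| =
    hamming_dist x y + 2 * #|diff_set x :&: diff_set y|.
Proof.
(* The reference word cancels: [x] and [y] differ exactly on the symmetric difference of their
   difference sets. *)
have -> : hamming_dist x y =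
    #|(diff_set x :|: diff_set y) :\: (diff_set x :&: diff_set y)|.
  by apply: eq_card => i; rewrite !inE; case: (x i) (y i) (x0 i) => [] [] [].
have := cardsUI (diff_set x) (diff_set y).
rewrite cardsDS; last by rewrite subIset // subsetUl.
suff : #|diff_set x :&: diff_set y| <= #|diff_set x :|: diff_set y| by lia.
by rewrite subset_leq_card // subIset // subsetUl.
Qed.

End ParityExtension.

(** * Upper and lower bounds with bounded error *)

Section Bounds.
Variable s : nat.
Let L : {pred nat} := pred2 (2 * s + 1) (2 * s + 2).

(** The first term covers codes too small for the sunflower argument; [s.+2] covers large ones, 1
    for the parity coordinate and [s.+1] for the removed word [x0]. *)
Definition code_excess : nat :=
  s.+1 * (2 ^ (2 * s.+1) * (2 * s.+1)).+2 + s.+2.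

Lemma code_upper_bound n (A : {set {ffun 'I_n -> bool}}) :
  has_dists L A -> #|A| * s.+1 <= n + code_excess.
Proof.
move=> /forall_inP LA.
have Ld x y : x \in A -> y \in A -> x != y ->
    hamming_dist x y = 2 * s + 1 \/ hamming_dist x y = 2 * s + 2.
  move=> xA yA xy; have /forall_inP/(_ y yA)/implyP/(_ xy) := LA x xA.
  by move=> /orP[/eqP|/eqP]; [left|right].
have [->|[x0 x0A]] := set_0Vmem A; first by rewrite cards0.
pose B := parity_ext x0.
have cB x : x \in A :\ x0 -> #|B x| = 2 * s.+1.
  rewrite !inE => /andP[xx0 xA]; rewrite card_parity_ext card_diff_set.
  by have := Ld _ _ xA x0A xx0; lia.
have cBI x y : x \in A :\ x0 -> y \in A :\ x0 -> x != y ->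
    #|B x :&: B y| = s.+1.
  rewrite !inE => /andP[xx0 xA] /andP[yx0 yA] xy; rewrite card_parity_extI.
  (* Parity decides the distance from [x] to [y]: it is [2 * s + 1] exactly when the distances to
     [x0] differ. The difference sets share [s] points if both are odd, [s.+1] otherwise. *)
  have := hamming_dist_diff_set x0 x y; rewrite !card_diff_set.
  have := Ld _ _ xA x0A xx0; have := Ld _ _ yA x0A yx0.
  have := Ld _ _ xA yA xy; lia.
have cF : #|B @: (A :\ x0)| = #|A :\ x0|.
  apply: card_in_imset => x y xA yA Bxy; apply/eqP; apply: contraT => xy.
  (* Equal images would meet in [2 * s.+1] points instead of [s.+1]. *)
  by have := cBI _ _ xA yA xy; rewrite Bxy setIid cB //; lia.
have := @large_equidistant_family _ s.+1 (B @: (A :\ x0)).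
rewrite cF card_option card_ord => bound.
have cA : #|A| = #|A :\ x0|.+1 by rewrite (cardsD1 x0) x0A.
rewrite /code_excess.
have [large|small] := ltnP (2 ^ (2 * s.+1) * (2 * s.+1)).+1 #|A :\ x0|.
  suff : #|A :\ x0| * s.+1 <= n.+1 by rewrite cA; nia.
  apply: bound => //.
    by move=> _ /imsetP[x xA ->]; apply: cB.
  move=> _ _ /imsetP[x xA ->] /imsetP[y yA ->] Bxy; apply: cBI => //.
  by apply: contraNneq Bxy => ->.
have : #|A| <= (2 ^ (2 * s.+1) * (2 * s.+1)).+2 by rewrite cA.
by rewrite mulnC -(leq_pmul2l (ltn0Sn s)); lia.
Qed.

(** The range of [j] leaves out an incomplete last block, so all blocks have full length. *)
Definition block_word n (j : 'I_(n %/ s.+1)) : {ffun 'I_n -> bool} :=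
  [ffun i : 'I_n => (i : nat) %/ s.+1 == j].

Lemma card_block n (j : 'I_(n %/ s.+1)) :
  #|[set i : 'I_n | block_word j i]| = s.+1.
Proof.
have ltjn (i : 'I_s.+1) : j * s.+1 + i < n.
  by have := leq_trunc_div n s.+1; have := ltn_ord j; have := ltn_ord i; nia.
pose g i := Ordinal (ltjn i).
have g_inj : injective g by move=> a b /(congr1 val) /= /addnI /val_inj.
rewrite -[RHS]card_ord -cardsT -(card_imset _ g_inj).
apply: eq_card => i; rewrite !inE ffunE.
apply/eqP/imsetP => [ij|[a _ ->]]; last first.
  by rewrite /= divnMDl // (divn_small (ltn_ord a)) addn0.
exists (Ordinal (ltn_pmod i (ltn0Sn s))) => //.
by apply: val_inj; rewrite /= -ij -divn_eq.
Qed.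

Lemma hamming_dist_block n (j l : 'I_(n %/ s.+1)) : j != l ->
  hamming_dist (block_word j) (block_word l) = 2 * s + 2.
Proof.
move=> jl.
have -> : hamming_dist (block_word j) (block_word l) =
    #|[set i | block_word j i] :|: [set i | block_word l i]|.
  apply: eq_card => i; rewrite !inE !ffunE.
  have [->|_] := eqVneq (i %/ s.+1) j.
    by rewrite (inj_eq val_inj) (negPf jl).
  by case: (_ == val l).
have /eqP := cardsUI [set i | block_word j i] [set i | block_word l i].
rewrite !card_block.
have -> : [set i | block_word j i] :&: [set i | block_word l i] = set0.
  apply/setP => i; rewrite !inE !ffunE.
  apply: contraNF jl => /andP[/eqP ij /eqP il].
  by apply/eqP/val_inj; rewrite /= -ij -il.
by rewrite cards0 => /eqP; lia.
Qed.

Lemma leq_max_code n : n %/ s.+1 <= max_code L n.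
Proof.
pose A := @block_word n @: [set: 'I_(n %/ s.+1)].
have block_inj : injective (@block_word n).
  move=> j l jl; apply/eqP; apply: contraT => /hamming_dist_block.
  rewrite jl /hamming_dist.
  have -> : [set i : 'I_n | block_word l i != block_word l i] = set0.
    by apply/setP => i; rewrite !inE eqxx.
  by rewrite cards0; lia.
have <- : #|A| = n %/ s.+1 by rewrite card_imset // cardsT card_ord.
apply: leq_bigmax_cond.
apply/forall_inP => _ /imsetP[j _ ->]; apply/forall_inP => _ /imsetP[l _ ->].
apply/implyP => jl; rewrite hamming_dist_block.
  by rewrite inE eqxx orbT.
by apply: contraNneq jl => ->.
Qed.

Lemma max_code_bounds n :
  n <= max_code L n * s.+1 + code_excess /\
  max_code L n * s.+1 <= n + code_excess.
Proof.
split.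
  have := leq_max_code n; have := divn_eq n s.+1.
  have := ltn_pmod n (ltn0Sn s); rewrite /code_excess; nia.
(* The empty code makes the family nonempty, so the maximum is attained by an actual code. *)
have L0 : has_dists L (set0 : {set {ffun 'I_n -> bool}}).
  by apply/forall_inP => x; rewrite inE.
rewrite /max_code (bigop.bigmax_eq_arg set0) //.
by case: arg_maxnP => // A LA _; exact: code_upper_bound.
Qed.

End Bounds.

(* Passage to the limit *)
From mathcomp Require Import all_order all_algebra.
From mathcomp Require Import all_classical all_reals all_analysis lra.

Import Order.TTheory GRing.Theory Num.Theory.
Import numFieldNormedType.Exports.
Local Open Scope classical_set_scope.
Local Open Scope ring_scope.

Theorem theorem6 (R : realType) (s : nat) :
  exists2 e : nat -> R, e n @[n --> \oo] --> (0 : R) &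
    \forall n \near \oo,
      (max_code (pred2 (2 * s + 1)%N (2 * s + 2)%N) n)%:R
        = (1 + e n) * (n%:R / (s.+1)%:R).
Proof.
pose f := max_code (pred2 (2 * s + 1)%N (2 * s + 2)%N).
(* The required equation solved for [e n]; at [n = 0] the quotient is 0 by convention, so the
   equation is claimed only for positive [n]. *)
exists (fun n => (f n)%:R * s.+1%:R / n%:R - 1).
  apply/cvgr0Pnorm_le => eps eps0.
  near=> n.
  have n0 : (0 : R) < n%:R by rewrite ltr0n; near: n; exact: nbhs_infty_gt.
  (* The two bounds give an error of at most [code_excess s] divided by [n]. *)
  have neps : (code_excess s)%:R / eps <= n%:R :> R.
    by near: n; exact: nbhs_infty_ger.
  have [lo up] := max_code_bounds s n.
  rewrite -[X in _ - X](divff (lt0r_neq0 n0)) -mulrBl normrM normfV.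
  rewrite (gtr0_norm n0) ler_pdivrMr //.
  apply: (@le_trans _ _ (code_excess s)%:R).
    rewrite ler_norml -natrM; move: lo up; rewrite -!(ler_nat R) !natrD.
    by rewrite -/(f n); lra.
  by rewrite mulrC -ler_pdivrMr.
near=> n.
have n0 : (n%:R : R) != 0.
  by rewrite pnatr_eq0 -lt0n; near: n; exact: nbhs_infty_gt.
by rewrite addrC subrK mulrA divfK // mulfK // pnatr_eq0.
Unshelve. all: by end_near.
Qed.
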